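(* Let $\mathcal{C}$ be a regular category, $A, B$ objects, and $R_a$ a subobject of $A \times B$, $R_b$ a subobject of $B \times A$. Suppose that for every subobject $p$ of $A$ there is an arrow $c : \mathbf{1} \to A$ such that the following regular sequents are valid in $\mathcal{C}$ (with $x$ of sort $A$, $y$ of sort $B$): (A1) $R_a(c,y) \wedge R_b(y,x) \vdash_{\{x,y\}} p(x)$, (A2) $R_a(c,y) \wedge p(x) \vdash_{\{x,y\}} R_b(y,x)$, (A3) $\vdash \exists y.\, R_a(c,y)$. Then every natural transformation $\tau : \mathsf{Sub} \Rightarrow \mathsf{Sub}$ has a fixpoint, i.e. there is $s \in \mathsf{Sub}(\mathbf{1})$ with $\tau_{\mathbf{1}}(s) = s$.
   Context: A regular category is a well-powered category with finite limits and images stable under pullback, with terminal object $\mathbf{1}$. $\mathsf{Sub}(A)$ is the poset of subobjects of $A$; for $f : A \to B$, $f^*:\mathsf{Sub}(B)\to\mathsf{Sub}(A)$ is pullback, giving a functor $\mathsf{Sub}:\mathcal{C}^{op}\to\mathbf{Set}$; a natural transformation $\tau:\mathsf{Sub}\Rightarrow\mathsf{Sub}$ is a family $\tau_A:\mathsf{Sub}(A)\to\mathsf{Sub}(A)$ with $f^*\circ\tau_B=\tau_A\circ f^*$. Regular formulas are interpreted as subobjects: relation symbols by the given subobjects, substitution by pullback, conjunction by meet, $\exists$ along a projection $\pi$ by the left adjoint of $\pi^*$. A sequent $\phi\vdash_X\psi$ is valid if $[\![\phi]\!]\le[\![\psi]\!]$ in the subobject poset of the product of the sorts of $X$; $\vdash_X\psi$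 means $\top\vdash_X\psi$. *)

(* Defs.v *)
(* regular categories defined from scratch (no category theory
   library is installed).  Subobjects are represented as monos, and Sub(A) as
   the setoid of monos into A modulo mutual factorisation. *)

Record Category : Type := {
  Obj :> Type;
  Hom : Obj -> Obj -> Type;
  idm : forall A, Hom A A;
  comp : forall {A B D}, Hom B D -> Hom A B -> Hom A D;
  comp_idl : forall A B (f : Hom A B), comp (idm B) f = f;
  comp_idr : forall A B (f : Hom A B), comp f (idm A) = f;
  comp_assoc : forall A B D E (h : Hom D E) (g : Hom B D) (f : Hom A B),
     comp h (comp g f) = comp (comp h g) f }.
Arguments Hom {c} _ _.
Arguments idm {c} A.
Arguments comp {c A B D} _ _.
Arguments comp_assoc {c A B D E} h g f.
Arguments comp_idl {c A B} f.
Arguments comp_idr {c A B} f.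

Section Basic.
Variable C : Category.

Definition mono {A B : C} (m : Hom A B) : Prop :=
  forall X (g h : Hom X A), comp m g = comp m h -> g = h.

Definition arr_le {M N A : C} (m : Hom M A) (n : Hom N A) : Prop :=
  exists h : Hom M N, comp n h = m.

Definition is_pullback {X Y Z P : C} (f : Hom X Z) (g : Hom Y Z)
    (p1 : Hom P X) (p2 : Hom P Y) : Prop :=
  comp f p1 = comp g p2 /\
  forall Q (q1 : Hom Q X) (q2 : Hom Q Y), comp f q1 = comp g q2 ->
    exists u : Hom Q P, (comp p1 u = q1 /\ comp p2 u = q2) /\
      forall v : Hom Q P, comp p1 v = q1 -> comp p2 v = q2 -> v = u.

Definition is_image {X Y M : C} (f : Hom X Y) (m : Hom M Y) : Prop :=
  mono m /\ (exists e : Hom X M, comp m e = f) /\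
  forall N (n : Hom N Y), mono n -> (exists e : Hom X N, comp n e = f) ->
    arr_le m n.

Record Sub (A : C) := { sdom : C; sarr : Hom sdom A; smono : mono sarr }.
Arguments sdom {A} s.
Arguments sarr {A} s.
Arguments smono {A} s.

Definition sub_le {A : C} (S T : Sub A) : Prop := arr_le (sarr S) (sarr T).
Definition sub_eq {A : C} (S T : Sub A) : Prop := sub_le S T /\ sub_le T S.

Lemma mono_id (A : C) : mono (idm A).
Proof. intros X g h H. rewrite !comp_idl in H. exact H. Qed.

Lemma mono_comp {A B D : C} {m : Hom B D} {n : Hom A B} :
  mono m -> mono n -> mono (comp m n).
Proof.
  intros Hm Hn X g h H. apply Hn, Hm. rewrite !comp_assoc. exact H.
Qed.

Definition top_sub (A : C) : Sub A := {| sarr := idm A; smono := @mono_id A |}.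

Definition compose_sub {A : C} (S : Sub A) (T : Sub (sdom S)) : Sub A :=
  {| sarr := comp (sarr S) (sarr T);
     smono := mono_comp (smono S) (smono T) |}.
End Basic.
Arguments Sub {C} A.
Arguments sdom {C A} s.
Arguments sarr {C A} s.
Arguments smono {C A} s.
Arguments sub_le {C A} S T.
Arguments sub_eq {C A} S T.
Arguments compose_sub {C A} S T.
Arguments mono {C A B} m.
Arguments arr_le {C M N A} m n.
Arguments is_image {C X Y M} f m.
Arguments is_pullback {C X Y Z P} f g p1 p2.
Arguments top_sub {C} A.

Record RegCat := {
  cat :> Category;
  one : Obj cat;
  bang : forall X : Obj cat, Hom X one;
  bang_unique : forall X (f : Hom X one), f = bang X;
  bprod : Obj cat -> Obj cat -> Obj cat;
  pr1 : forall A B, Hom (bprod A B) A;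
  pr2 : forall A B, Hom (bprod A B) B;
  pair : forall {X A B}, Hom X A -> Hom X B -> Hom X (bprod A B);
  pair_pr1 : forall X A B (f : Hom X A) (g : Hom X B),
      comp (pr1 A B) (pair f g) = f;
  pair_pr2 : forall X A B (f : Hom X A) (g : Hom X B),
      comp (pr2 A B) (pair f g) = g;
  pair_unique : forall X A B (h : Hom X (bprod A B)),
      h = pair (comp (pr1 A B) h) (comp (pr2 A B) h);
  pb : forall {X Y Z}, Hom X Z -> Hom Y Z -> Obj cat;
  pb1 : forall {X Y Z} (f : Hom X Z) (g : Hom Y Z), Hom (pb f g) X;
  pb2 : forall {X Y Z} (f : Hom X Z) (g : Hom Y Z), Hom (pb f g) Y;
  pb_is_pullback : forall X Y Z (f : Hom X Z) (g : Hom Y Z),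
      is_pullback f g (pb1 f g) (pb2 f g);
  has_image : forall X Y (f : Hom X Y), exists (M : Obj cat) (m : Hom M Y), is_image f m;
  image_stable : forall X Y Z (f : Hom X Y) (g : Hom Z Y) (M : Obj cat) (m : Hom M Y),
      is_image f m -> is_image (pb2 f g) (pb2 m g) }.
Arguments one {r}.
Arguments bang {r} X.
Arguments bprod {r} A B.
Arguments pr1 {r} A B.
Arguments pr2 {r} A B.
Arguments pair {r X A B} f g.
Arguments pb {r X Y Z} f g.
Arguments pb1 {r X Y Z} f g.
Arguments pb2 {r X Y Z} f g.
Arguments pb_is_pullback {r X Y Z} f g.

Section Reg.
Variable C : RegCat.

Lemma pb2_mono {X Y Z : C} {m : Hom X Z} (g : Hom Y Z) :
  mono m -> mono (pb2 m g).
Proof.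
  intros Hm Q a b H.
  destruct (pb_is_pullback m g) as [Hsq Hu].
  assert (E1 : comp (pb1 m g) a = comp (pb1 m g) b).
  { apply Hm. rewrite !comp_assoc, Hsq, <- !comp_assoc, H. reflexivity. }
  assert (Hc : comp m (comp (pb1 m g) a) = comp g (comp (pb2 m g) a)).
  { rewrite !comp_assoc, Hsq. reflexivity. }
  destruct (Hu _ _ _ Hc) as [u [_ Hun]].
  rewrite (Hun a eq_refl eq_refl), (Hun b (eq_sym E1) (eq_sym H)). reflexivity.
Qed.

Definition pullback_sub {A B : C} (f : Hom A B) (S : Sub B) : Sub A :=
  {| sarr := pb2 (sarr S) f; smono := pb2_mono f (smono S) |}.

Definition meet {A : C} (S T : Sub A) : Sub A :=
  compose_sub S (pullback_sub (sarr S) T).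
End Reg.
Arguments pullback_sub {C A B} f S.
Arguments meet {C A} S T.

(* A natural transformation Sub => Sub, Sub(A) being the quotient of the
   setoid of monos: a family of maps respecting the equivalence and natural
   (pullback along f commutes with tau) up to the equivalence. *)
Record NatTrans (C : RegCat) := {
  ntc : forall {A : Obj C}, Sub A -> Sub A;
  nt_resp : forall A (S T : Sub A), sub_eq S T -> sub_eq (ntc S) (ntc T);
  nt_nat : forall A B (f : Hom A B) (S : Sub B),
      sub_eq (pullback_sub f (ntc S)) (ntc (pullback_sub f S)) }.
Arguments ntc {C} n {A} S.
Arguments nt_resp {C} n {A} S T _.
Arguments nt_nat {C} n {A B} f S.

(* Main.v *)
Require Import Defs.
From Stdlib Require Import Setoid.

(* A diagonal argument in the style of Lawvere.  Let q be the subobject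
   { x : A | exists y, Ra(x,y) /\ Rb(y,x) } of A, and pick c for p := tau q.
   Substituting x := c, (A1) gives c^* q <= c^* (tau q); conversely (A3)
   provides some y with Ra(c,y), (A2) then gives Rb(y,c), so c lies in q.
   Hence c^* q = c^* (tau q) = tau (c^* q) by naturality. *)

Section GeneralisedElements.
Context {C : RegCat}.

Definition in_sub {W A : C} (e : Hom W A) (S : Sub A) : Prop := arr_le e (sarr S).

Definition image_sub {X Y M : C} {f : Hom X Y} {m : Hom M Y}
  (H : is_image f m) : Sub Y := {| sarr := m; smono := proj1 H |}.

Lemma hom_to_one_eq {X : C} (f g : Hom X one) : f = g.
Proof. rewrite (bang_unique _ _ f), (bang_unique _ _ g). reflexivity. Qed.

Lemma pair_ext {X A B : C} (h k : Hom X (bprod A B)) :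
  comp (pr1 A B) h = comp (pr1 A B) k -> comp (pr2 A B) h = comp (pr2 A B) k ->
  h = k.
Proof.
  intros H1 H2. rewrite (pair_unique _ _ _ _ h), (pair_unique _ _ _ _ k), H1, H2.
  reflexivity.
Qed.

Lemma comp_pair {X Y A B : C} (f : Hom Y A) (g : Hom Y B) (h : Hom X Y) :
  comp (pair f g) h = pair (comp f h) (comp g h).
Proof.
  apply pair_ext.
  - rewrite comp_assoc, !pair_pr1. reflexivity.
  - rewrite comp_assoc, !pair_pr2. reflexivity.
Qed.

Lemma arr_le_trans {M N K Y : C} (a : Hom M Y) (b : Hom N Y) (c : Hom K Y) :
  arr_le a b -> arr_le b c -> arr_le a c.
Proof.
  intros [h H] [k Hk]. exists (comp k h). rewrite comp_assoc, Hk, H. reflexivity.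
Qed.

Lemma in_sub_comp {V W A : C} (e : Hom W A) (h : Hom V W) (S : Sub A) :
  in_sub e S -> in_sub (comp e h) S.
Proof. intros [u Hu]. exists (comp u h). rewrite comp_assoc, Hu. reflexivity. Qed.

Lemma in_sub_sarr {A : C} (S : Sub A) : in_sub (sarr S) S.
Proof. exists (idm _). apply comp_idr. Qed.

Lemma in_image_sub {X Y M W : C} (f : Hom X Y) (m : Hom M Y)
  (H : is_image f m) (h : Hom W X) : in_sub (comp f h) (image_sub H).
Proof. apply in_sub_comp. exact (proj1 (proj2 H)). Qed.

Lemma in_pullback_sub {W A B : C} (f : Hom A B) (S : Sub B) (e : Hom W A) :
  in_sub e (pullback_sub f S) <-> in_sub (comp f e) S.
Proof.
  destruct (pb_is_pullback (sarr S) f) as [Hsq Hu]. split.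
  - intros [u Hue]. exists (comp (pb1 (sarr S) f) u).
    rewrite comp_assoc, Hsq, <- comp_assoc, <- Hue. reflexivity.
  - intros [a Ha]. destruct (Hu W a e Ha) as [u [[_ H2] _]]. exists u. exact H2.
Qed.

Lemma in_meet {W A : C} (S T : Sub A) (e : Hom W A) :
  in_sub e (meet S T) <-> in_sub e S /\ in_sub e T.
Proof.
  destruct (pb_is_pullback (sarr T) (sarr S)) as [Hsq Hu]. split.
  - intros [u Hue]. split.
    + exists (comp (pb2 (sarr T) (sarr S)) u). rewrite comp_assoc. exact Hue.
    + exists (comp (pb1 (sarr T) (sarr S)) u). rewrite comp_assoc, Hsq. exact Hue.
  - intros [[a Ha] [b Hb]].
    assert (Hab : comp (sarr T) b = comp (sarr S) a) by (rewrite Ha, Hb; reflexivity).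
    destruct (Hu W b a Hab) as [u [[_ H2] _]]. exists u. simpl.
    rewrite <- comp_assoc, H2. exact Ha.
Qed.

(* Covers are stable under pullback, so the image of [pb2 f g] is all of [Z]. *)
Lemma in_sub_of_cover {D Y Z : C} (f : Hom D Y) (g : Hom Z Y) (T : Sub Y) :
  (forall M (m : Hom M Y), is_image f m -> arr_le (idm Y) m) ->
  in_sub (comp g (pb2 f g)) T -> in_sub g T.
Proof.
  intros Hcover HT.
  destruct (has_image C D Y f) as [M [m Hm]].
  destruct (Hcover M m Hm) as [s Hs].
  destruct (image_stable C D Y Z f g M m Hm) as [_ [_ Hleast]].
  assert (Hpb_le : arr_le (pb2 m g) (sarr (pullback_sub g T))).
  { apply Hleast; [exact (smono (pullback_sub g T))|]. apply in_pullback_sub, HT. }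
  assert (Hsec : comp m (comp s g) = comp g (idm Z))
    by (rewrite comp_assoc, Hs, comp_idl, comp_idr; reflexivity).
  destruct (proj2 (pb_is_pullback m g) Z _ _ Hsec) as [t [[_ Ht] _]].
  assert (Hid : in_sub (idm Z) (pullback_sub g T)).
  { rewrite <- Ht. apply in_sub_comp, Hpb_le. }
  apply in_pullback_sub in Hid. rewrite comp_idr in Hid. exact Hid.
Qed.

End GeneralisedElements.

Section Diagonal.
Context {C : RegCat} {A B : C} (Ra : Sub (bprod A B)) (Rb : Sub (bprod B A)).

Definition diag_rel : Sub (bprod A B) :=
  meet Ra (pullback_sub (pair (pr2 A B) (pr1 A B)) Rb).

Lemma in_diag_rel {W : C} (x : Hom W A) (y : Hom W B) :
  in_sub (pair x y) diag_rel <-> in_sub (pair x y) Ra /\ in_sub (pair y x) Rb.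
Proof.
  unfold diag_rel. rewrite in_meet, in_pullback_sub, comp_pair, pair_pr1, pair_pr2.
  reflexivity.
Qed.

Variable c : Hom one A.

Lemma in_Ra_at {W : C} (e : Hom W (bprod A B)) :
  in_sub e (pullback_sub (pair (comp c (bang (bprod A B))) (pr2 A B)) Ra) <->
  in_sub (pair (comp c (bang W)) (comp (pr2 A B) e)) Ra.
Proof.
  rewrite in_pullback_sub, comp_pair, <- comp_assoc,
    (hom_to_one_eq (comp (bang _) e) (bang W)).
  reflexivity.
Qed.

Lemma in_Ra_fibre {W : C} (y : Hom W B) :
  in_sub y (pullback_sub (pair (comp c (bang B)) (idm B)) Ra) <->
  in_sub (pair (comp c (bang W)) y) Ra.
Proof.
  rewrite in_pullback_sub, comp_pair, comp_idl, <- comp_assoc,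
    (hom_to_one_eq (comp (bang B) y) (bang W)).
  reflexivity.
Qed.

Variable p : Sub A.

Lemma in_p_of_diag_rel
  (A1 : sub_le (meet (pullback_sub (pair (comp c (bang (bprod A B))) (pr2 A B)) Ra)
                     (pullback_sub (pair (pr2 A B) (pr1 A B)) Rb))
               (pullback_sub (pr1 A B) p))
  {W : C} (y : Hom W B) :
  in_sub (pair (comp c (bang W)) y) diag_rel -> in_sub (comp c (bang W)) p.
Proof.
  intros Hdiag. apply in_diag_rel in Hdiag as [HRa HRb].
  assert (Hseq : in_sub (pair (comp c (bang W)) y) (pullback_sub (pr1 A B) p)).
  { eapply arr_le_trans; [|exact A1]. apply in_meet; split.
    - apply in_Ra_at. rewrite pair_pr2. exact HRa.
    - apply in_pullback_sub. rewrite comp_pair, pair_pr1, pair_pr2. exact HRb. }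
  apply in_pullback_sub in Hseq. rewrite pair_pr1 in Hseq. exact Hseq.
Qed.

Lemma in_diag_rel_of_p
  (A2 : sub_le (meet (pullback_sub (pair (comp c (bang (bprod A B))) (pr2 A B)) Ra)
                     (pullback_sub (pr1 A B) p))
               (pullback_sub (pair (pr2 A B) (pr1 A B)) Rb))
  {W : C} (y : Hom W B) :
  in_sub y (pullback_sub (pair (comp c (bang B)) (idm B)) Ra) ->
  in_sub (comp c (bang W)) p -> in_sub (pair (comp c (bang W)) y) diag_rel.
Proof.
  intros Hy Hp. apply in_Ra_fibre in Hy.
  apply in_diag_rel. split; [exact Hy|].
  assert (Hseq : in_sub (pair (comp c (bang W)) y)
                        (pullback_sub (pair (pr2 A B) (pr1 A B)) Rb)).
  { eapply arr_le_trans; [|exact A2]. apply in_meet; split.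
    - apply in_Ra_at. rewrite pair_pr2. exact Hy.
    - apply in_pullback_sub. rewrite pair_pr1. exact Hp. }
  apply in_pullback_sub in Hseq. rewrite comp_pair, pair_pr1, pair_pr2 in Hseq.
  exact Hseq.
Qed.

Variables (Q : C) (mq : Hom Q A) (Hq : is_image (comp (pr1 A B) (sarr diag_rel)) mq).

Lemma pullback_diag_image_le
  (A1 : sub_le (meet (pullback_sub (pair (comp c (bang (bprod A B))) (pr2 A B)) Ra)
                     (pullback_sub (pair (pr2 A B) (pr1 A B)) Rb))
               (pullback_sub (pr1 A B) p)) :
  sub_le (pullback_sub c (image_sub Hq)) (pullback_sub c p).
Proof.
  (* [c^* q] is the image of the pullback of [diag_rel] along [x = c]. *)
  set (f := comp (pr1 A B) (sarr diag_rel)).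
  destruct (image_stable C _ _ _ f c Q mq Hq) as [_ [_ Hleast]].
  apply Hleast; [exact (smono (pullback_sub c p))|].
  apply in_pullback_sub.
  set (e := comp (sarr diag_rel) (pb1 f c)).
  assert (He : e = pair (comp c (bang _)) (comp (pr2 A B) e)).
  { apply pair_ext; rewrite ?pair_pr1, ?pair_pr2; [|reflexivity].
    unfold e. rewrite comp_assoc. fold f. rewrite (proj1 (pb_is_pullback f c)).
    rewrite (hom_to_one_eq (pb2 f c) (bang _)). reflexivity. }
  rewrite (hom_to_one_eq (pb2 f c) (bang _)).
  apply (in_p_of_diag_rel A1 (comp (pr2 A B) e)).
  rewrite <- He. apply in_sub_comp, in_sub_sarr.
Qed.

Lemma pullback_le_diag_image
  (A2 : sub_le (meet (pullback_sub (pair (comp c (bang (bprod A B))) (pr2 A B)) Ra)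
                     (pullback_sub (pr1 A B) p))
               (pullback_sub (pair (pr2 A B) (pr1 A B)) Rb))
  (A3 : forall (M : C) (m : Hom M one),
        is_image (comp (bang B)
                   (sarr (pullback_sub (pair (comp c (bang B)) (idm B)) Ra))) m ->
        arr_le (idm one) m) :
  sub_le (pullback_sub c p) (pullback_sub c (image_sub Hq)).
Proof.
  set (Rac := pullback_sub (pair (comp c (bang B)) (idm B)) Ra).
  set (f := comp (bang B) (sarr Rac)).
  set (g := sarr (pullback_sub c p)).
  (* By (A3), [Ra(c,-)] covers [1]; it suffices to work over its pullback. *)
  apply (in_sub_of_cover f g _ A3), in_pullback_sub.
  set (y := comp (sarr Rac) (pb1 f g)).
  assert (Hdiag : in_sub (pair (comp c (bang _)) y) diag_rel).
  { apply (in_diag_rel_of_p A2).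
    - apply in_sub_comp, in_sub_sarr.
    - rewrite (hom_to_one_eq (bang _) (comp g (pb2 f g))), comp_assoc.
      apply in_sub_comp, in_pullback_sub, in_sub_sarr. }
  destruct Hdiag as [u Hu].
  rewrite (hom_to_one_eq (comp g (pb2 f g)) (bang _)),
    <- (pair_pr1 _ _ _ _ (comp c (bang _)) y), <- Hu, comp_assoc.
  apply in_image_sub.
Qed.

End Diagonal.

Theorem lemma7 (C : RegCat) (A B : Obj C)
  (Ra : Sub (bprod A B)) (Rb : Sub (bprod B A)) :
  (forall p : Sub A, exists c : Hom one A,
     (* context {x : A, y : B} is interpreted in bprod A B, x = pr1, y = pr2 *)
     (* (A1) Ra(c,y) /\ Rb(y,x) |- p(x) *)
     sub_le (meet (pullback_sub (pair (comp c (bang (bprod A B))) (pr2 A B)) Ra)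
                  (pullback_sub (pair (pr2 A B) (pr1 A B)) Rb))
            (pullback_sub (pr1 A B) p) /\
     (* (A2) Ra(c,y) /\ p(x) |- Rb(y,x) *)
     sub_le (meet (pullback_sub (pair (comp c (bang (bprod A B))) (pr2 A B)) Ra)
                  (pullback_sub (pr1 A B) p))
            (pullback_sub (pair (pr2 A B) (pr1 A B)) Rb) /\
     (* (A3) |- exists y. Ra(c,y): the image of [[Ra(c,y)]] >-> B -> 1 is top *)
     (forall (M : Obj C) (m : Hom M one),
        is_image (comp (bang B)
                   (sarr (pullback_sub (pair (comp c (bang B)) (idm B)) Ra))) m ->
        arr_le (idm one) m)) ->
  forall tau : NatTrans C, exists s : Sub (@one C), sub_eq (ntc tau s) s.
Proof.
  intros Hsurj tau.
  destruct (has_image C _ _ (comp (pr1 A B) (sarr (diag_rel Ra Rb)))) as [Q [mq Hq]].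
  set (q := image_sub Hq).
  destruct (Hsurj (ntc tau q)) as [c [A1 [A2 A3]]].
  exists (pullback_sub c q).
  destruct (nt_nat tau c q) as [Hnat1 Hnat2].
  split.
  - exact (arr_le_trans _ _ _ Hnat2 (pullback_le_diag_image Ra Rb c _ Q mq Hq A2 A3)).
  - exact (arr_le_trans _ _ _ (pullback_diag_image_le Ra Rb c _ Q mq Hq A1) Hnat1).
Qed.
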